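(* Let $G$ be the control-flow graph of a program $S$ without while loop statements. For each node $N$ of $G$ and each program variable $x$ there exists an evaluation function $$V^N_x\in[\mathcal T|_{\mathrm{prov}(N,x)}\to\mathcal V]$$ such that for all traces $\mathtt{tr}$, for the initial state $\sigma_0$ mapping all program variables to $\mathtt{null}$ and $\mathbf p$ to $1$, and for the execution sequence $$(\sigma_0,\mathrm{START})\xrightarrow{\mathtt{tr}}\cdots\xrightarrow{\mathtt{tr}}(\sigma_i,N_i)\xrightarrow{\mathtt{tr}}\cdots\xrightarrow{\mathtt{tr}}(\sigma_l,\mathrm{END})$$ in $G$ (whenever it exists), we have $\sigma_i(x)=V^{N_i}_x(\mathtt{tr})$ for all $i$ and all program variables $x$.
   Context: **Language.** $\mathcal V$ is the set of values (booleans, integers, reals, real vectors, finite strings, and a special value $\mathtt{null}$); $\mathbf{Strings}\subset\mathcal V$ is the set of finite strings (addresses). Expressions: $E::=c\mid x\mid g(E_1,\dots,E_n)$ with $c\in\mathcal V$ a constant, $x$ a program variable (finitely many), $g$ a built-in total function on values. $\mathrm{vars}(E)$ is the set of program variables in $E$. Statements (without while loops): $S::= x=E\mid S_1;S_2\mid \mathtt{if}\,E\,\mathtt{then}\,S_1\,\mathtt{else}\,S_2\mid\mathtt{skip}\mid x=\mathtt{sample}(E_0,f(E_1,\dots,E_n))$, with $f$ a built-in distribution having a function $\mathrm{pdf}_f(v;v_1,\dots,v_n)\in\mathbb R_{\ge0}$. The address expression $E_0$ is assumed to evaluate to a string. A program is a statement. **Traces and states.** A trace is a map $\mathtt{tr}:\mathbf{Strings}\to\mathcal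 V$; $\mathcal T$ is the set of all traces. A state $\sigma\in\Sigma$ assigns a value to every program variable and a number in $\mathbb R_{\ge0}$ to a reserved variable $\mathbf p$ (not a program variable, not occurring in programs); it is lifted to expressions by $\sigma(c)=c$, $\sigma(g(E_1,\dots,E_n))=g(\sigma(E_1),\dots,\sigma(E_n))$. **CFG.** The control-flow graph $G$ of $S$ is a directed graph with one START, one END node, and branch nodes $\mathrm{Branch}(E)$, join nodes, assign nodes $\mathrm{Assign}(x=E)$ and sample nodes $\mathrm{Assign}(x=\mathtt{sample}(\dots))$ (sample nodes are also assign nodes). Every occurrence of a statement yields its own nodes. $\mathtt{skip}$: START$\to$END. Assignment/sample: START$\to$Assign$\to$END. $S_1;S_2$: remove END of $G_1$ and START of $G_2$ and connect the predecessor of END in $G_1$ to the successor of START in $G_2$. $\mathtt{if}\,E$: START$\to B=\mathrm{Branch}(E)$; $B$ has successors consequent$(B)$ = first node of (the interior of) $G_1$, alternative$(B)$ = first node of $G_2$; the last nodes of $G_1$, $G_2$ go to a join node $J$; $J\to$END (a $\mathtt{skip}$ branch is a direct edge $B\to J$). Then $(B,J)\in\mathrm{BranchJoin}(G)$ and $\mathrm{condexp}(B)=E$. **Graph semantics.** Transitions $(\sigma,N)\xrightarrow{\mathtt{tr}}(\sigma',N')$: START and join nodes move to their successor with $\sigma'=\sigma$; $\mathrm{Assign}(x=E)$ moves to its successor with $\sigma'=\sigma[x\mapsto\sigma(E)]$; $\mathrm{Assign}(x=\mathtt{sample}(E_0,f(E_1,\dots,E_n)))$ moves to its successor, provided $V_i=\sigma(E_i)\ne\mathtt{null}$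 for all $i=0,\dots,n$, $V_0\in\mathbf{Strings}$ and $V=\mathtt{tr}(V_0)\ne\mathtt{null}$, with $\sigma'=\sigma[x\mapsto V,\mathbf p\mapsto\sigma(\mathbf p)\cdot\mathrm{pdf}_f(V;V_1,\dots,V_n)]$; $\mathrm{Branch}(E)$ moves with $\sigma'=\sigma$ to consequent if $\sigma(E)=\mathtt{true}$, to alternative if $\sigma(E)=\mathtt{false}$. **Provenance.** $\mathrm{RD}(N,x)$ is the set of assign nodes $N'$ assigning $x$ (including sample nodes) for which there is a path $(N',N_1,\dots,N_n,N)$, $n\ge0$, with no $N_i$ assigning $x$. $\mathrm{BP}(N)=\{B:(B,J)\in\mathrm{BranchJoin}(G),\ \exists\text{ path }(B,\dots,N,\dots,J)\}$. For a sample node with address expression $E_0$, $\mathrm{addresses}(N)=\{\sigma(E_0):\sigma\in\Sigma\}\cap\mathbf{Strings}$. $\mathrm{prov}(N,x)$: let $R$ be the least set of pairs containing $(N,x)$ such that whenever $(M,z)\in R$ and $N'\in\mathrm{RD}(M,z)$, then (i) $(N',y)\in R$ for all $y\in\mathrm{vars}(E')$, where $E'=E$ if $N'=\mathrm{Assign}(z=E)$ and $E'=E_0$ if $N'=\mathrm{Assign}(z=\mathtt{sample}(E_0,\dots))$; (ii) $(B,y)\in R$ for all $B\in\mathrm{BP}(N')$, $y\in\mathrm{vars}(\mathrm{condexp}(B))$. Then $\mathrm{prov}(N,x)$ is the union of $\mathrm{addresses}(N')$ over all sample nodes $N'\in\mathrm{RD}(M,z)$ with $(M,z)\in R$. **Restricted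 functions.** For $A\subseteq\mathbf{Strings}$ and a set $C$, $[\mathcal T|_A\to C]$ is the set of functions $h:\mathcal T\to C$ such that $h(\mathtt{tr})=h(\mathtt{tr}')$ whenever $\mathtt{tr}(\alpha)=\mathtt{tr}'(\alpha)$ for all $\alpha\in A$. *)

(* Defs.v *)
From HB Require Import structures.
From Stdlib Require Import String.
From mathcomp Require Import all_boot all_order all_algebra.
From mathcomp Require Import all_classical reals interval_inference.

Set Implicit Arguments.
Unset Strict Implicit.
Unset Printing Implicit Defensive.

Local Open Scope classical_set_scope.

Inductive node (I : Type) : Type := START | END | Inner of I.
Arguments START {I}.
Arguments END {I}.

Definition node_encode I (N : node I) : option (option I) :=
  match N with START => None | END => Some None | Inner n => Some (Some n) end.
Definition node_decode I (o : option (option I)) : node I :=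
  match o with None => START | Some None => END | Some (Some n) => Inner n end.
Lemma node_encodeK I : cancel (@node_encode I) (@node_decode I).
Proof. by case. Qed.
HB.instance Definition _ (I : finType) :=
  Finite.copy (node I) (can_type (@node_encodeK I)).

Section Language.
Context {R : realType}.

Inductive value : Type :=
| VBool of bool
| VInt of int
| VReal of R
| VVec (n : nat) of 'rV[R]_n
| VStr of string
| VNull.

(* A built-in function symbol [g] denotes a total function on tuples of
   values; a built-in distribution symbol [f] comes with the function
   [pdf f v vs], i.e. pdf_f(v; v_1, ..., v_n). *)
Record builtins : Type := Builtins {
  fsym : Type;
  farity : fsym -> nat;
  fsem : forall g : fsym, (farity g).-tuple value -> value;
  dsym : Type;
  darity : dsym -> nat;
  pdf : forall f : dsym, value -> (darity f).-tuple value -> {nonneg R}%R }.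

Context {X : finType} {bi : builtins}.

Inductive expr : Type :=
| Const of value
| Var of X
| App (g : fsym bi) of ('I_(farity g) -> expr).

Inductive stmt : Type :=
| Assign (x : X) (E : expr)
| Seq (S1 S2 : stmt)
| If (E : expr) (S1 S2 : stmt)
| Skip
| Sample (x : X) (E0 : expr) (f : dsym bi) (Es : 'I_(darity f) -> expr).

Fixpoint vars (E : expr) : set X :=
  match E with
  | Const _ => set0
  | Var x => [set x]
  | App _ Es => \bigcup_i vars (Es i)
  end.

Definition trace : Type := string -> value.

(* [pval] is the value of the reserved variable p. *)
Record state : Type := State {
  val_of :> X -> value;
  pval : {nonneg R}%R }.

Definition init_state : state := State (fun=> VNull) 1%:nng%R.

Definition upd (s : X -> value) (x : X) (v : value) : X -> value :=
  fun y => if y == x then v else s y.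

Fixpoint eval (s : state) (E : expr) : value :=
  match E with
  | Const c => c
  | Var x => s x
  | App g Es => fsem [tuple eval s (Es i) | i < farity g]
  end.

Inductive label : Type :=
| LBranch (E : expr)
| LJoin
| LAssign (x : X) (E : expr)
| LSample (x : X) (E0 : expr) (f : dsym bi) (Es : 'I_(darity f) -> expr).

(* [inner] is the type of the nodes other than START and END.
   [branch_succ b B N] says that N is consequent(B) if [b] is [true], and
   alternative(B) if [b] is [false]; it may hold for both values of [b] with
   the same N, when both branches are empty. *)
Record cfg : Type := Cfg {
  inner : finType;
  lab : inner -> label;
  edge : rel (node inner);
  branch_join : rel inner;
  branch_succ : bool -> rel inner }.
Arguments edge G : clear implicits, rename.

Definition cfg_skip : cfg := @Cfg void
  (fun n => match n with end)
  (fun u v => if (u, v) is (START, END) then true else false)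
  (fun _ _ => false)
  (fun _ _ _ => false).

Definition cfg_single (l : label) : cfg := @Cfg unit
  (fun=> l)
  (fun u v => match u, v with
    | START, Inner _ | Inner _, END => true
    | _, _ => false
    end)
  (fun _ _ => false)
  (fun _ _ _ => false).

(* END of [G1] and START of [G2] disappear; every pair of edges
   (u, END) in [G1] and (START, v) in [G2] is fused into an edge (u, v). *)
Definition cfg_seq (G1 G2 : cfg) : cfg := @Cfg (inner G1 + inner G2)%type
  (fun n => match n with inl m => lab m | inr m => lab m end)
  (fun u v => match u, v with
    | START,         Inner (inl n) => edge G1 START (Inner n)
    | Inner (inl m), Inner (inl n) => edge G1 (Inner m) (Inner n)
    | Inner (inr m), Inner (inr n) => edge G2 (Inner m) (Inner n)
    | Inner (inr m), END           => edge G2 (Inner m) END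
    | START,         Inner (inr n) =>
        edge G1 START END && edge G2 START (Inner n)
    | Inner (inl m), Inner (inr n) =>
        edge G1 (Inner m) END && edge G2 START (Inner n)
    | START,         END           =>
        edge G1 START END && edge G2 START END
    | Inner (inl m), END           =>
        edge G1 (Inner m) END && edge G2 START END
    | _, _ => false
    end)
  (fun B J => match B, J with
    | inl B, inl J => branch_join B J
    | inr B, inr J => branch_join B J
    | _, _ => false
    end)
  (fun b B n => match B, n with
    | inl B, inl n => branch_succ b B n
    | inr B, inr n => branch_succ b B n
    | _, _ => false
    end).

(* [IfB] and [IfJ] are the new branch and join nodes: START of [G1] and of [G2]
   is identified with [IfB], and END of [G1] and of [G2] with [IfJ]. *)
Local Notation IfB := (inl true).
Local Notation IfJ := (inl false).
Local Notation In1 n := (inr (inl n)).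
Local Notation In2 n := (inr (inr n)).

Definition cfg_if (E : expr) (G1 G2 : cfg) : cfg :=
  @Cfg (bool + (inner G1 + inner G2))%type
  (fun n => match n with
    | IfB => LBranch E
    | IfJ => LJoin
    | In1 m => lab m
    | In2 m => lab m
    end)
  (fun u v => match u, v with
    | START,         Inner IfB     => true
    | Inner IfB,     Inner (In1 n) => edge G1 START (Inner n)
    | Inner IfB,     Inner (In2 n) => edge G2 START (Inner n)
    | Inner IfB,     Inner IfJ     =>
        edge G1 START END || edge G2 START END
    | Inner (In1 m), Inner (In1 n) => edge G1 (Inner m) (Inner n)
    | Inner (In2 m), Inner (In2 n) => edge G2 (Inner m) (Inner n)
    | Inner (In1 m), Inner IfJ     => edge G1 (Inner m) END
    | Inner (In2 m), Inner IfJ     => edge G2 (Inner m) END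
    | Inner IfJ,     END           => true
    | _, _ => false
    end)
  (fun B J => match B, J with
    | IfB, IfJ => true
    | In1 B, In1 J => branch_join B J
    | In2 B, In2 J => branch_join B J
    | _, _ => false
    end)
  (fun b B n => match B, n with
    | IfB, In1 n => b && edge G1 START (Inner n)
    | IfB, In2 n => ~~ b && edge G2 START (Inner n)
    | IfB, IfJ =>
        if b then edge G1 START END else edge G2 START END
    | In1 B, In1 n => branch_succ b B n
    | In2 B, In2 n => branch_succ b B n
    | _, _ => false
    end).

Fixpoint cfg_of (S : stmt) : cfg :=
  match S with
  | Assign x E => cfg_single (LAssign x E)
  | Seq S1 S2 => cfg_seq (cfg_of S1) (cfg_of S2)
  | If E S1 S2 => cfg_if E (cfg_of S1) (cfg_of S2)
  | Skip => cfg_skip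
  | Sample x E0 f Es => cfg_single (LSample x E0 Es)
  end.

Section Semantics.
Context {G : cfg}.

Inductive step (tr : trace) :
    state * node (inner G) -> state * node (inner G) -> Prop :=
| step_start s N :
    edge G START N -> step tr (s, START) (s, N)
| step_join s n N :
    lab n = LJoin -> edge G (Inner n) N -> step tr (s, Inner n) (s, N)
| step_assign s n x E N :
    lab n = LAssign x E -> edge G (Inner n) N ->
    step tr (s, Inner n) (State (upd s x (eval s E)) (pval s), N)
| step_sample s n x E0 (f : dsym bi) (Es : 'I_(darity f) -> expr) N a :
    lab n = LSample x E0 Es -> edge G (Inner n) N ->
    eval s E0 = VStr a ->
    (forall i, eval s (Es i) <> VNull) ->
    tr a <> VNull ->
    step tr (s, Inner n)
      (State (upd s x (tr a))
         ((pval s)%:num *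
          (pdf (tr a) [tuple eval s (Es i) | i < darity f])%:num)%:nng%R, N)
| step_branch s n E b m :
    lab n = LBranch E -> eval s E = VBool b -> branch_succ b n m ->
    step tr (s, Inner n) (s, Inner m).

Definition assigns (N : node (inner G)) (x : X) : bool :=
  match N with
  | Inner n => match lab n with
      | LAssign y _ => y == x
      | LSample y _ _ _ => y == x
      | _ => false
      end
  | _ => false
  end.

Definition RD (N : node (inner G)) (x : X) : set (inner G) :=
  [set N' | assigns (Inner N') x /\
     exists p : seq (node (inner G)),
       path (edge G) (Inner N') (rcons p N) /\
       all (fun M => ~~ assigns M x) p].

Definition BP (N : node (inner G)) : set (inner G) :=
  [set B | exists J, branch_join B J /\
     exists p : seq (node (inner G)),
       [/\ path (edge G) (Inner B) p, last (Inner B) p = Inner J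
         & N \in Inner B :: p]].

Definition addresses (n : inner G) : set string :=
  match lab n with
  | LSample _ E0 _ _ => [set a | exists s : state, eval s E0 = VStr a]
  | _ => set0
  end.

(* The variables on which the value stored by an assign node depends directly:
   only the address expression counts for a sample node. *)
Definition dep_vars (n : inner G) : set X :=
  match lab n with
  | LAssign _ E => vars E
  | LSample _ E0 _ _ => vars E0
  | _ => set0
  end.

Inductive prov_rel (N : node (inner G)) (x : X) :
    node (inner G) -> X -> Prop :=
| prov_base : prov_rel N x N x
| prov_data M z N' y :
    prov_rel N x M z -> RD M z N' -> dep_vars N' y ->
    prov_rel N x (Inner N') y
| prov_ctrl M z N' B E y :
    prov_rel N x M z -> RD M z N' -> BP (Inner N') B ->
    lab B = LBranch E -> vars E y ->
    prov_rel N x (Inner B) y.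

Definition prov (N : node (inner G)) (x : X) : set string :=
  [set a | exists M z N',
     [/\ prov_rel N x M z, RD M z N' & addresses N' a]].

End Semantics.

Definition restricted (A : set string) (C : Type) : set (trace -> C) :=
  [set h | forall tr tr' : trace,
     (forall a, A a -> tr a = tr' a) -> h tr = h tr'].

End Language.

Arguments value R : clear implicits.
Arguments builtins R : clear implicits.
Arguments trace R : clear implicits.
Arguments stmt {R} X bi.
Arguments state R X : clear implicits.
Arguments edge {R X bi} G : rename.

(* Main.v *)
(** Two complete runs that pass through the same node [N] and whose traces agree
    on [prov N x] give [x] the same value at [N]; [V N x] is then the value given
    by any complete run through [N] whose trace agrees with the argument on
    [prov N x].  The proof is by induction along the loop-free graph.  If [N'] is
    the node that last assigned [x] in the first run, then [N'] lies in [RD N x]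
    and the branch nodes of the conditionals around [N'] lie in [BP N'], so by
    induction both runs take the same sides of these conditionals, and the second
    run also visits [N'].  By symmetry, each run visits the last assignment of the
    other before [N], so these are the same node, and the variables and the
    address it reads are covered by [prov N x]. *)

Require Import Defs.
From mathcomp Require Import all_boot all_order all_algebra.
From mathcomp Require Import all_classical reals.
From mathcomp Require Import zify.

Set Implicit Arguments.
Unset Strict Implicit.
Unset Printing Implicit Defensive.

Section Provenance.
Context {R : realType} {X : finType} {bi : builtins R}.
Implicit Types (S : stmt X bi) (tr : trace R).

(** * Textual order and guards of the nodes *)

Fixpoint inner_size S : nat :=
  match S with
  | Seq S1 S2 => inner_size S1 + inner_size S2
  | If _ S1 S2 => (inner_size S1 + inner_size S2).+2
  | Skip => 0
  | _ => 1
  end.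

(* The textual order of the nodes: a consequent comes before its alternative. *)
Fixpoint pos S : inner (cfg_of S) -> nat :=
  match S with
  | Seq S1 S2 => fun n => match n with
      | inl m => pos m
      | inr m => inner_size S1 + pos m
      end
  | If _ S1 S2 => fun n => match n with
      | inl true => 0
      | inl false => (inner_size S1 + inner_size S2).+1
      | inr (inl m) => (pos m).+1
      | inr (inr m) => (inner_size S1 + pos m).+1
      end
  | _ => fun=> 0
  end.

(** Strictly increasing along every edge ([rank_edge]), so it orders the nodes of a run and is the
    measure of the main induction. *)
Definition rank S (u : node (inner (cfg_of S))) : nat :=
  match u with
  | START => 0
  | Inner n => (pos n).+1
  | END => (inner_size S).+1
  end.

(* [guard n B b]: the occurrence of [n] lies in the consequent ([b = true]) or
   the alternative ([b = false]) of the conditional with branch node [B]. *)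
Fixpoint guard S : inner (cfg_of S) -> inner (cfg_of S) -> bool -> bool :=
  match S with
  | Seq S1 S2 => fun n B b => match n, B with
      | inl m, inl C => guard m C b
      | inr m, inr C => guard m C b
      | _, _ => false
      end
  | If _ S1 S2 => fun n B b => match n, B with
      | inr (inl m), inl true => b
      | inr (inr m), inl true => ~~ b
      | inr (inl m), inr (inl C) => guard m C b
      | inr (inr m), inr (inr C) => guard m C b
      | _, _ => false
      end
  | _ => fun _ _ _ => false
  end.

Definition node_guard S (u : node (inner (cfg_of S))) B b : bool :=
  if u is Inner n then guard n B b else false.

Definition is_branch (l : @label R X bi) : bool :=
  if l is LBranch _ then true else false.

Definition branch_node S (u : node (inner (cfg_of S))) : bool :=
  if u is Inner n then is_branch (lab n) else false.

Lemma pos_lt S (n : inner (cfg_of S)) : pos n < inner_size S.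
Proof.
elim: S n => /= [x E|S1 IH1 S2 IH2|E S1 IH1 S2 IH2||x E0 f Es] //.
- by case=> n; [have := IH1 n|have := IH2 n]; lia.
- by case=> [[]|[n|n]] /=; try have := IH1 n; try have := IH2 n; lia.
Qed.

Lemma pos_inj S : injective (@pos S).
Proof.
elim: S => /= [x E|S1 IH1 S2 IH2|E S1 IH1 S2 IH2||x E0 f Es].
- by case; case.
- move=> [n|n] [m|m] h.
  + by rewrite (IH1 _ _ h).
  + by have := pos_lt n; lia.
  + by have := pos_lt m; lia.
  + by congr inr; apply: IH2; lia.
- move=> [[]|[n|n]] [[]|[m|m]] // h;
    try have := pos_lt n; try have := pos_lt m; try lia.
  + by move=> *; congr (inr (inl _)); apply: IH1; lia.
  + by move=> *; congr (inr (inr _)); apply: IH2; lia.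
- by case.
- by case; case.
Qed.

(** * Edges compared with the textual order and the guards *)

Lemma rank_edge S (u v : node (inner (cfg_of S))) :
  edge (cfg_of S) u v -> rank u < rank v.
Proof.
elim: S u v => /= [x E|S1 IH1 S2 IH2|E S1 IH1 S2 IH2||x E0 f Es].
- by case=> [||n] [||m].
- move=> [||[n|n]] [||[m|m]] //=.
  + by move=> /andP[/IH1 + /IH2] => /=; lia.
  + by move=> /IH1.
  + by move=> /andP[/IH1 + /IH2] => /=; lia.
  + by move=> /IH2 /=; lia.
  + by move=> /IH2 /=; lia.
- by move=> [||[[]|[n|n]]] [||[[]|[m|m]]] //=;
    try (by move=> /IH1 /=; lia); try (by move=> /IH2 /=; lia); lia.
- by case=> [||n] [||m].
- by case=> [||n] [||m].
Qed.

Lemma succ_edge S b (n m : inner (cfg_of S)) :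
  branch_succ b n m -> edge (cfg_of S) (Inner n) (Inner m).
Proof.
elim: S n m => //= [S1 IH1 S2 IH2|E S1 IH1 S2 IH2].
- by move=> [n|n] [m|m] //; [apply: IH1|apply: IH2].
- move=> [[]|[n|n]] [[]|[m|m]] //; try by case/andP.
  + by case: b {IH1 IH2} => ->; rewrite ?orbT.
  + exact: IH1.
  + exact: IH2.
Qed.

(** A side of a conditional is entered only from its branch node, so an edge from any other node
    adds no guard. *)
Lemma guard_edge S (u v : node (inner (cfg_of S))) B b :
  edge (cfg_of S) u v -> ~~ branch_node u -> node_guard v B b ->
  node_guard u B b.
Proof.
elim: S u v B b => //= [x E|S1 IH1 S2 IH2|E S1 IH1 S2 IH2|x E0 f Es].
- by case=> [||n] [||m].
- move=> [||[n|n]] [||[m|m]] [B|B] b //=.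
  + exact: (IH1 START (Inner m)).
  + by move=> /andP[_ h]; exact: (IH2 START (Inner m)).
  + exact: (IH1 (Inner n) (Inner m)).
  + by move=> /andP[_ h] _; exact: (IH2 START (Inner m)).
  + exact: (IH2 (Inner n) (Inner m)).
- move=> [||[[]|[n|n]]] [||[[]|[m|m]]] [[]|[B|B]] b //=.
  + exact: (IH1 (Inner n) (Inner m)).
  + exact: (IH2 (Inner n) (Inner m)).
- by case=> [||n] [||m].
Qed.

Lemma guard_start S (n : inner (cfg_of S)) B b :
  edge (cfg_of S) START (Inner n) -> guard n B b = false.
Proof. by move=> h; apply/negP => /(guard_edge (v := Inner n) h isT). Qed.

Lemma guard_succ S c (n m : inner (cfg_of S)) B b :
  branch_succ c n m -> guard m B b -> guard n B b \/ B = n /\ b = c.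
Proof.
elim: S n m B => //= [S1 IH1 S2 IH2|E S1 IH1 S2 IH2].
- move=> [n|n] [m|m] [B|B] //= h g.
  + by case: (IH1 _ _ _ h g) => [->|[-> ->]]; [left|right].
  + by case: (IH2 _ _ _ h g) => [->|[-> ->]]; [left|right].
- move=> [[]|[n|n]] [[]|[m|m]] [[]|[B|B]] //= h g; try by left.
  + by right; case: (c) h; case: (b) g.
  + by case/andP: h => _ /guard_start h; rewrite h in g.
  + by right; case: (c) h; case: (b) g.
  + by case/andP: h => _ /guard_start h; rewrite h in g.
  + by case: (IH1 _ _ _ h g) => [->|[-> ->]]; [left|right].
  + by case: (IH2 _ _ _ h g) => [->|[-> ->]]; [left|right].
Qed.

Lemma guard_trans S (n B C : inner (cfg_of S)) b c :
  guard n B b -> guard B C c -> guard n C c.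
Proof.
elim: S n B C => //= [S1 IH1 S2 IH2|E S1 IH1 S2 IH2].
- by move=> [n|n] [B|B] [C|C] //; [apply: IH1|apply: IH2].
- by move=> [[]|[n|n]] [[]|[B|B]] [[]|[C|C]] //; [apply: IH1|apply: IH2].
Qed.

Lemma guard_lt S (n B : inner (cfg_of S)) b : guard n B b -> pos B < pos n.
Proof.
elim: S n B => //= [S1 IH1 S2 IH2|E S1 IH1 S2 IH2].
- by move=> [n|n] [B|B] // g; [have := IH1 _ _ g|have := IH2 _ _ g]; lia.
- move=> [[]|[n|n]] [[]|[B|B]] // g; first by have := IH1 _ _ g; lia.
  by have := IH2 _ _ g; lia.
Qed.

(** The witness is the join node matching [B]. The last clause lets [run_visits] apply to [J]
    whenever it applies to [B]. *)
Lemma guard_join S (n B : inner (cfg_of S)) b :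
  guard n B b -> exists J, [/\ branch_join B J, pos n < pos J
    & forall C c, guard J C c -> guard B C c].
Proof.
elim: S n B => //= [S1 IH1 S2 IH2|E S1 IH1 S2 IH2].
- move=> [n|n] [B|B] //.
  + move=> /IH1[J [BJ lt_nJ gJ]]; exists (inl J); split=> //.
    by case.
  + move=> /IH2[J [BJ lt_nJ gJ]]; exists (inr J); split=> //; first lia.
    by case.
- move=> [[]|[n|n]] [[]|[B|B]] //.
  + by exists (inl false); split=> //; have := pos_lt n; lia.
  + move=> /IH1[J [BJ lt_nJ gJ]]; exists (inr (inl J)); split=> //.
    by case=> [[]|[]].
  + by exists (inl false); split=> //; have := pos_lt n; lia.
  + move=> /IH2[J [BJ lt_nJ gJ]]; exists (inr (inr J)); split=> //; first lia.
    by case=> [[]|[]].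
Qed.

(* An edge only jumps over nodes on the other side of some conditional; hence a
   complete run visits every node whose guards it satisfies. *)
Lemma skip_edge S (u v : node (inner (cfg_of S))) n :
  edge (cfg_of S) u v -> ~~ branch_node u -> rank u < (pos n).+1 < rank v ->
  exists B b, node_guard u B b /\ guard n B (~~ b).
Proof.
elim: S u v n => /= [x E|S1 IH1 S2 IH2|E S1 IH1 S2 IH2||x E0 f Es].
- by case=> [||m] [||m'] n.
- move=> [||[k|k]] [||[m|m]] [n|n] //=; rewrite ?addnS ?ltnS;
    try have nS := pos_lt n; try have mS := pos_lt m; try have kS := pos_lt k;
    try (by move=> *; lia).
  (* A fused edge that bypasses all of one component comes from its edge START to END; the induction
     hypothesis would put a guard on START, which has none. *)
  + move=> /andP[e _] _ r.
    by have [|B [b []]] := IH1 START END n e isT _.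
  + move=> /andP[_ e] _ r.
    have [|B [b []]] := IH2 START END n e isT _ => //=; lia.
  + move=> e _ r.
    by have [|B [b []]] := IH1 START (Inner m) n e isT _.
  + move=> /andP[e _] _ r.
    by have [|B [b []]] := IH1 START END n e isT _.
  + move=> /andP[_ e] _ r.
    have [|B [b []]] := IH2 START (Inner m) n e isT _ => //=; lia.
  + move=> /andP[e _] nb r.
    have [|B [b []]] := IH1 (Inner k) END n e nb _; first by move=> /=; lia.
    by exists (inl B), b.
  + move=> /andP[_ e] _ r.
    have [|B [b []]] := IH2 START END n e isT _ => //=; lia.
  + move=> e nb r.
    have [|B [b []]] := IH1 (Inner k) (Inner m) n e nb _; first by move=> /=; lia.
    by exists (inl B), b.
  + move=> /andP[e _] nb r.
    have [|B [b []]] := IH1 (Inner k) END n e nb _; first by move=> /=; lia.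
    by exists (inl B), b.
  + move=> /andP[_ e] _ r.
    have [|B [b []]] := IH2 START (Inner m) n e isT _ => //=; lia.
  + move=> e nb r.
    have [|B [b []]] := IH2 (Inner k) END n e nb _; first by move=> /=; lia.
    by exists (inr B), b.
  + move=> e nb r.
    have [|B [b []]] := IH2 (Inner k) (Inner m) n e nb _; first by move=> /=; lia.
    by exists (inr B), b.
- move=> [||[[]|[k|k]]] [||[[]|[m|m]]] [[]|[n|n]] //=; rewrite ?addnS ?ltnS;
    try have nS := pos_lt n; try have mS := pos_lt m; try have kS := pos_lt k;
    try (by move=> *; lia).
  + move=> e nb r.
    have [|B [b []]] := IH1 (Inner k) END n e nb _; first by move=> /=; lia.
    by exists (inr (inl B)), b.
  (* The exit of the consequent jumps over the alternative, which lies under the opposite guard. *)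
  + by exists (inl true), true.
  + move=> e nb r.
    have [|B [b []]] := IH1 (Inner k) (Inner m) n e nb _; first by move=> /=; lia.
    by exists (inr (inl B)), b.
  + move=> e nb r.
    have [|B [b []]] := IH2 (Inner k) END n e nb _; first by move=> /=; lia.
    by exists (inr (inr B)), b.
  + move=> e nb r.
    have [|B [b []]] := IH2 (Inner k) (Inner m) n e nb _; first by move=> /=; lia.
    by exists (inr (inr B)), b.
- by [].
- by case=> [||m] [||m'] n.
Qed.

Lemma skip_start S v (n : inner (cfg_of S)) :
  edge (cfg_of S) START v -> rank v <= (pos n).+1.
Proof.
move=> e; rewrite leqNgt; apply/negP => r.
by have [|B [b []]] := @skip_edge _ START v n e isT _.
Qed.

(** An edge leaving a branch node [k] may also jump over the side of [k] not taken, hence the second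
    disjunct. *)
Lemma skip_succ S c (k m n : inner (cfg_of S)) :
  branch_succ c k m -> pos k < pos n < pos m ->
  (exists B b, guard k B b /\ guard n B (~~ b)) \/ guard n k (~~ c).
Proof.
elim: S k m n => //= [S1 IH1 S2 IH2|E S1 IH1 S2 IH2].
- move=> [k|k] [m|m] [n|n] //= e r;
    try have nS := pos_lt n; try have mS := pos_lt m; try have kS := pos_lt k;
    try (by lia).
  + have [|[B [b []]]|] := IH1 k m n e _; [lia| |by right].
    by left; exists (inl B), b.
  + have [|[B [b []]]|] := IH2 k m n e _; [lia| |by right].
    by left; exists (inr B), b.
- move=> [[]|[k|k]] [[]|[m|m]] [[]|[n|n]] //= e r;
    try have nS := pos_lt n; try have mS := pos_lt m; try have kS := pos_lt k;
    try (by lia).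
  (* The edge to the join node crosses an empty side; a skipped node must lie on the other one. *)
  + case: (c) e => [/skip_start - /(_ n)|_] /=; [lia|by right].
  + case: (c) e => [_|/skip_start - /(_ n)] /=; [by right|lia].
  + case: (c) e => //= /skip_start - /(_ n) /=; lia.
  + case: (c) e => //= /skip_start - /(_ n) /=; lia.
  + have [|[B [b []]]|] := IH1 k m n e _; [lia| |by right].
    by left; exists (inr (inl B)), b.
  + have [|[B [b []]]|] := IH2 k m n e _; [lia| |by right].
    by left; exists (inr (inr B)), b.
Qed.

(** * Single execution steps *)

Definition takes S (p : state R X * node (inner (cfg_of S))) B b : Prop :=
  p.2 = Inner B /\ exists2 E, lab B = LBranch E & eval p.1 E = VBool b.

Lemma step_edge S tr (p q : state R X * node (inner (cfg_of S))) :
  step tr p q -> edge (cfg_of S) p.2 q.2.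
Proof. by case=> //= s n E b m _ _; apply: succ_edge. Qed.

Lemma step_guard S tr (p q : state R X * node (inner (cfg_of S))) B b :
  step tr p q -> node_guard q.2 B b -> node_guard p.2 B b \/ takes p B b.
Proof.
case=> /= [s N e|s n N labn e|s n x E N labn e|s n x E0 f Es N a labn e _ _ _
  |s n E c m labn ev e] g.
- by left; apply: (guard_edge e _ g).
- by left; apply: (guard_edge e _ g); rewrite /= labn.
- by left; apply: (guard_edge e _ g); rewrite /= labn.
- by left; apply: (guard_edge e _ g); rewrite /= labn.
- by case: (guard_succ e g) => [|[-> ->]]; [left|right; split=> //; exists E].
Qed.

Lemma step_skip S tr (p q : state R X * node (inner (cfg_of S))) n :
  step tr p q -> rank p.2 < rank (Inner n) < rank q.2 ->
  exists B b, (node_guard p.2 B b \/ takes p B b) /\ guard n B (~~ b).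
Proof.
case=> /= [s N e|s k N labn e|s k x E N labn e|s k x E0 f Es N a labn e _ _ _
  |s k E c m labn ev e] r.
- by have [//|B [b []]] := skip_edge e _ r; exists B, b; split=> //; left.
- have [|B [b []]] := skip_edge e _ r; first by rewrite /= labn.
  by exists B, b; split=> //; left.
- have [|B [b []]] := skip_edge e _ r; first by rewrite /= labn.
  by exists B, b; split=> //; left.
- have [|B [b []]] := skip_edge e _ r; first by rewrite /= labn.
  by exists B, b; split=> //; left.
- case: (skip_succ e r) => [[B [b []]]|g].
    by exists B, b; split=> //; left.
  by exists k, c; split=> //; right; split=> //; exists E.
Qed.

Lemma step_unassigned S tr (p q : state R X * node (inner (cfg_of S))) x :
  step tr p q -> ~~ assigns p.2 x -> q.1 x = p.1 x.
Proof.
by case=> //= [s n y E N labn _|s n y E0 f Es N a labn _ _ _ _];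
  rewrite labn /upd eq_sym => /negbTE ->.
Qed.

Lemma eval_ext (s s' : state R X) (E : @expr R X bi) :
  (forall y, vars E y -> s y = s' y) -> eval s E = eval s' E.
Proof.
elim: E => //= [x|g Es IH] eqs; first exact: eqs.
congr fsem; apply: eq_mktuple => i; apply: IH => y Ey.
by apply: eqs; exists i.
Qed.

Lemma step_assigned S tr (p q : state R X * node (inner (cfg_of S))) n x :
  step tr p q -> p.2 = Inner n -> assigns (Inner n) x ->
  match lab n with
  | LAssign _ E => q.1 x = eval p.1 E
  | LSample _ E0 _ _ => exists2 a, eval p.1 E0 = VStr a & q.1 x = tr a
  | _ => False
  end.
Proof.
case=> /= [//|s m N labm e|s m y E N labm e|s m y E0 f Es N a labm e ev _ _
  |s m E c k labm _ _] [<-]; rewrite labm //.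
- by rewrite /upd eq_sym => ->.
- by move=> /eqP ->; exists a; rewrite // /upd eqxx.
Qed.

(** For a sample node, agreement on [dep_vars] makes both runs read the same address, and the traces
    agree there. *)
Lemma step_assigned_eq S tr tr' (p q p' q' : state R X * node (inner (cfg_of S)))
    n x :
  step tr p q -> step tr' p' q' -> p.2 = Inner n -> p'.2 = Inner n ->
  assigns (Inner n) x -> (forall y, dep_vars n y -> p.1 y = p'.1 y) ->
  (forall a, addresses n a -> tr a = tr' a) -> q.1 x = q'.1 x.
Proof.
move=> st st' pn pn' asg; rewrite /dep_vars /addresses.
move: (step_assigned st pn asg) (step_assigned st' pn' asg).
case: (lab n) => // [y E -> -> eqs _|y E0 f Es [a ev ->] [a' + ->] eqs eqtr].
  exact: eval_ext.
rewrite -(eval_ext eqs) ev => -[<-]; apply: eqtr.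
by exists p.1.
Qed.

Lemma prov_rel_trans S (N M M' : node (inner (cfg_of S))) x z z' :
  prov_rel N x M z -> prov_rel M z M' z' -> prov_rel N x M' z'.
Proof.
move=> NM; elim=> // [P y N' w _ IH rd dep|P y N' B E w _ IH rd bp labB Ew].
  exact: prov_data IH rd dep.
exact: prov_ctrl IH rd bp labB Ew.
Qed.

(** Carries agreement of traces on [prov N x] over to every dependency of [x] at [N], as the
    induction hypothesis requires. *)
Lemma prov_sub S (N M : node (inner (cfg_of S))) x z :
  prov_rel N x M z -> forall a, prov M z a -> prov N x a.
Proof.
move=> NM a [P [y [N' [MP rd Na]]]]; exists P, y, N'; split=> //.
exact: prov_rel_trans NM MP.
Qed.

(** * Complete runs *)

Definition complete_run S tr l (s : nat -> state R X)
    (N : nat -> node (inner (cfg_of S))) : Prop :=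
  [/\ s 0 = init_state, N 0 = START, N l = END
    & forall i, i < l -> step tr (s i, N i) (s i.+1, N i.+1)].

Section OneRun.
Context {S : stmt X bi} {tr : trace R} {l : nat} {s : nat -> state R X}.
Context {N : nat -> node (inner (cfg_of S))}.
Hypothesis runN : complete_run tr l s N.

Lemma run_rank i j : i < j <= l -> rank (N i) < rank (N j).
Proof.
case: runN => _ _ _ st; elim: j => // j IH; rewrite ltnS => /andP[ij jl].
have := rank_edge (step_edge (st _ jl)) => /=.
move: ij; rewrite leq_eqVlt => /predU1P[-> //|ij]; apply: ltn_trans.
by apply: IH; rewrite ij ltnW.
Qed.

Lemma run_le i j : i <= l -> j <= l -> rank (N i) < rank (N j) -> i < j.
Proof.
move=> il jl; rewrite !ltnNge; apply: contraNN; rewrite leq_eqVlt.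
by move=> /predU1P[-> //|ji]; rewrite ltnW // run_rank // ji.
Qed.

Lemma run_inj i j : i <= l -> j <= l -> N i = N j -> i = j.
Proof.
move=> il jl eqN; case: (ltngtP i j) => // ij.
- by have := @run_rank i j; rewrite ij jl eqN ltnn => /(_ isT).
- by have := @run_rank j i; rewrite ij il eqN ltnn => /(_ isT).
Qed.

Lemma run_path i d : i + d <= l ->
  path (edge (cfg_of S)) (N i) (map N (iota i.+1 d)).
Proof.
case: runN => _ _ _ st; elim: d i => // d IH i; rewrite addnS -addSn => idl /=.
by rewrite IH // andbT; apply: (step_edge (st i _)); lia.
Qed.

(** START has no guard, so each guard at step [i] was acquired at an earlier step by taking that
    side. *)
Lemma run_guard i B b : i <= l -> node_guard (N i) B b ->
  exists2 k, k < i & takes (s k, N k) B b.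
Proof.
case: runN => _ N0 _ st; elim: i => [|i IH] il; first by rewrite N0.
move=> /(step_guard (st i il))[|]; last by exists i.
by move=> /(IH (ltnW il))[k ki tk]; exists k => //; apply: ltnW.
Qed.

(** Some step reaches or jumps over the rank of [n]. A jump needs a conditional with [n] on the side
    not taken, against the hypothesis that the run takes the sides guarding [n]. *)
Lemma run_visits n :
  (forall B b, guard n B b -> exists2 k, k < l & takes (s k, N k) B b) ->
  exists2 i, i < l & N i = Inner n.
Proof.
move=> gn; case: (runN) => _ N0 Nl st.
(* Discrete intermediate value argument: ranks climb from START, below [n], to END, above it. *)
have [i il /andP[lo hi]] :
    exists2 i, i < l & rank (N i) < rank (Inner n) <= rank (N i.+1).
  have : rank (Inner n) <= rank (N l) by rewrite Nl ltnW //= ltnS pos_lt.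
  elim: (l) => [|j IH]; first by rewrite N0.
  move=> hj; case: (leqP (rank (Inner n)) (rank (N j))) => [/IH[i ij ?]|ltj].
    by exists i => //; apply: ltnW.
  by exists j => //; rewrite ltj hj.
move: hi; rewrite leq_eqVlt => /predU1P[eqn|hi].
  exists i.+1.
    case: (ltngtP i.+1 l) => [//||il1]; first lia.
    by move: eqn; rewrite il1 Nl /= => -[]; have := pos_lt n; lia.
  case: (N i.+1) eqn => [||m] //=; first by have := pos_lt n; lia.
  by move=> [/pos_inj ->].
have [|B [b [tkB /gn[k kl tk]]]] := step_skip (n := n) (st i il) _; first by rewrite lo hi.
have [k' k'l tk'] : exists2 k', k' < l & takes (s k', N k') B b.
  case: tkB => [/(run_guard (ltnW il))[k' ki tk']|tkB]; last by exists i.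
  by exists k' => //; lia.
case: tk tk' => /= Nk [E labB ev] [Nk' [E' labB' ev']].
(* [B] is visited only once, so its condition would have both values [b] and [~~ b]. *)
have kk' : k = k' by apply: run_inj; rewrite ?Nk ?Nk' // ltnW.
move: ev ev'; rewrite kk'; move: labB'; rewrite labB => -[->] -> [].
by case: (b).
Qed.

(** The guards of [B] and of its join node are among those of [n], so the run visits both; its
    segment between them is the required path through [n]. *)
Lemma run_BP i n B b : i <= l -> N i = Inner n -> guard n B b ->
  BP (Inner n) B.
Proof.
move=> il Nn g; have [J [BJ nJ gJ]] := guard_join g.
have gB C c : guard B C c -> exists2 k, k < l & takes (s k, N k) C c.
  move=> gC; have [|k ki tk] := @run_guard i C c il.
    by rewrite Nn; apply: guard_trans g gC.
  by exists k => //; apply: leq_trans il.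
have [k kl NB] := run_visits gB.
have [j jl NJ] := run_visits (fun C c gC => gB C c (gJ C c gC)).
have ki : k < i by apply: (run_le (ltnW kl) il); rewrite NB Nn /= ltnS (guard_lt g).
have ij : i < j by apply: (run_le il (ltnW jl)); rewrite NJ Nn /= ltnS.
exists J; split=> //; exists (map N (iota k.+1 (j - k))); split.
- by rewrite -NB; apply: run_path; lia.
- rewrite -NJ (_ : j - k = (j - k.+1) + 1); last lia.
  rewrite iotaD map_cat last_cat /=; congr N; lia.
- by rewrite inE -Nn map_f ?orbT // mem_iota; lia.
Qed.

(** After the last assignment the run itself is an assignment-free path, which is the witness for
    [RD]. *)
Lemma run_last_assign i x : i <= l ->
  s i x = VNull /\ (forall j, j < i -> ~~ assigns (N j) x) \/
  exists j n, [/\ j < i, N j = Inner n, RD (N i) x n,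
    forall k, j < k < i -> ~~ assigns (N k) x & s i x = s j.+1 x].
Proof.
move=> il; case: (runN) => s0 _ _ st.
(* [RD] is left out of the induction on [i] because it refers to the end node [N i]. *)
have H : s i x = VNull /\ (forall j, j < i -> ~~ assigns (N j) x) \/
  exists j, [/\ j < i, assigns (N j) x, (forall k, j < k < i -> ~~ assigns (N k) x)
             & s i x = s j.+1 x].
  elim: i il => [|i IH] il; first by left; rewrite s0; split.
  case: (boolP (assigns (N i) x)) => asg.
    by right; exists i; split=> // k; lia.
  have := step_unassigned (st i il) asg => /= ->.
  case: (IH (ltnW il)) => [[-> na]|[j [ji asj na ->]]].
    by left; split=> // j; rewrite ltnS leq_eqVlt => /predU1P[->|/na].
  right; exists j; split=> //; first exact: ltnW.
  move=> k /andP[jk]; rewrite ltnS leq_eqVlt => /predU1P[-> //|ki].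
  by apply: na; rewrite jk.
case: H => [|[j [ji asg na eqs]]]; [by left|right].
case Nj: (N j) asg => [||n] // asg; exists j, n; split=> //; split=> //.
exists (map N (iota j.+1 (i - j.+1))); split.
  rewrite -cats1 (_ : [:: N i] = map N (iota (j.+1 + (i - j.+1)) 1)).
    by rewrite -map_cat -iotaD -Nj; apply: run_path; lia.
  by rewrite /= subnKC.
by apply/allP => M /mapP[k + ->]; rewrite mem_iota => h; apply: na; lia.
Qed.

End OneRun.

(** * Comparison of two runs *)

(** The first implication is the induction hypothesis of [run_value]. It makes the second run decide
    the conditionals around [n] as the first does, so [run_visits] applies. *)
Lemma run_transfer S tr tr' l l' s s' N N' (u : node (inner (cfg_of S))) x j n :
  complete_run tr l s N -> complete_run tr' l' s' N' ->
  (forall k k' y, k <= l -> k' <= l' -> N k = N' k' -> rank (N k) < rank u ->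
    (forall a, prov (N k) y a -> tr a = tr' a) -> s k y = s' k' y) ->
  (forall a, prov u x a -> tr a = tr' a) ->
  j <= l -> N j = Inner n -> RD u x n -> rank (Inner n) < rank u ->
  exists2 j', j' < l' & N' j' = Inner n.
Proof.
move=> rN rN' eqs agr jl Nj rd nu.
apply: (run_visits rN') => B b g.
(* Outer conditionals first: the guards of [B] have smaller position. *)
elim: {B}(pos B).+1 {-2}B (ltnSn (pos B)) b g => // m IH B Bm b g.
have gN : node_guard (N j) B b by rewrite Nj.
have [k kj [/= Nk [E labB ev]]] := run_guard rN jl gN.
have [k' kl' Nk'] : exists2 k', k' < l' & N' k' = Inner B.
  apply: (run_visits rN') => C c gC; apply: IH; last exact: guard_trans g gC.
  by apply: leq_trans (guard_lt gC) _.
exists k' => //; split=> //=; exists E => //; rewrite -ev.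
(* Since [B] is in [BP] of [n], the provenance of each variable of its condition lies in
   [prov u x]. *)
apply/esym/eval_ext => y Ey; apply: eqs; rewrite ?Nk ?Nk' //.
- by apply: leq_trans jl; apply: ltnW.
- exact: ltnW.
- by apply: leq_ltn_trans nu; rewrite /= ltnW // ltnS (guard_lt g).
- move=> a /(prov_sub (prov_ctrl (prov_base u x) rd (run_BP rN jl Nj g) labB Ey)).
  exact: agr.
Qed.

Lemma run_value S tr tr' l l' s s' (N N' : nat -> node (inner (cfg_of S))) :
  complete_run tr l s N -> complete_run tr' l' s' N' ->
  forall i i' x, i <= l -> i' <= l' -> N i = N' i' ->
  (forall a, prov (N i) x a -> tr a = tr' a) -> s i x = s' i' x.
Proof.
move=> rN rN' i i' x il i'l' eqN agr.
have [m im] := ubnP (rank (N i)).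
elim: m => // m IH in i i' x im il i'l' eqN agr *.
have IH' k k' y : k <= l -> k' <= l' -> N k = N' k' -> rank (N k) < rank (N i) ->
    (forall a, prov (N k) y a -> tr a = tr' a) -> s k y = s' k' y.
  by move=> kl k'l' eqNk ki; apply: IH => //; apply: leq_trans ki _.
have fwd j n : j < i -> N j = Inner n -> RD (N i) x n ->
    exists2 j', j' < i' & N' j' = Inner n.
  move=> ji Nj rd.
  have ni : rank (Inner n) < rank (N i) by rewrite -Nj (run_rank rN) // ji.
  have jl : j <= l by apply: leq_trans (ltnW ji) il.
  have [j' j'l' Nj'] := run_transfer rN rN' IH' agr jl Nj rd ni.
  by exists j' => //; apply: (run_le rN' (ltnW j'l') i'l'); rewrite Nj' -eqN.
have bwd j' n : j' < i' -> N' j' = Inner n -> RD (N i) x n ->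
    exists2 j, j < i & N j = Inner n.
  move=> ji' Nj' rd.
  have ni : rank (Inner n) < rank (N i) by rewrite eqN -Nj' (run_rank rN') // ji'.
  have jl' : j' <= l' by apply: leq_trans (ltnW ji') i'l'.
  have [|a /agr -> //|j jl Nj] := run_transfer rN' rN _ _ jl' Nj' rd ni.
    move=> k' k y kl' kl eqk ki pa; apply/esym/IH' => //; rewrite -eqk //.
    by move=> a /pa ->.
  by exists j => //; apply: (run_le rN (ltnW jl) il); rewrite Nj.
have [[-> na]|[j [n [ji Nj rd na ->]]]] := run_last_assign rN x il;
  have [[-> na']|[j' [n' [ji' Nj' rd' na' ->]]]] := run_last_assign rN' x i'l'.
- by [].
(* If only one run assigned [x], the other would have to visit that assign node too. *)
- have [|k ki Nk] := bwd _ _ ji' Nj'; first by rewrite eqN.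
  by have := na _ ki; rewrite Nk; case: rd' => ->.
- have [k ki Nk] := fwd _ _ ji Nj rd.
  by have := na' _ ki; rewrite Nk; case: rd => ->.
rewrite -eqN in rd'.
have [k ki Nk] := bwd _ _ ji' Nj' rd'; have [k' ki' Nk'] := fwd _ _ ji Nj rd.
(* [j] is the last index before [i] whose node assigns [x]. *)
have kj : k <= j.
  by apply/contraT; rewrite -ltnNge => jk; have := na k;
    rewrite jk ki Nk => /(_ isT); case: rd' => ->.
have kj' : k' <= j'.
  by apply/contraT; rewrite -ltnNge => jk; have := na' k';
    rewrite jk ki' Nk' => /(_ isT); case: rd => ->.
(* Each last assignment occurs in the other run no later than that run's own last assignment, so
   their ranks coincide. *)
have nn' : n = n'.
  have le1 : rank (N k) <= rank (N j).
    move: kj; rewrite leq_eqVlt => /predU1P[-> //|kj].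
    by rewrite ltnW // (run_rank rN) // kj; lia.
  have le2 : rank (N' k') <= rank (N' j').
    move: kj'; rewrite leq_eqVlt => /predU1P[-> //|kj'].
    by rewrite ltnW // (run_rank rN') // kj'; lia.
  apply: pos_inj; apply/eqP; rewrite eqn_leq.
  by move: le1 le2; rewrite Nk Nj Nk' Nj' /= !ltnS => -> ->.
subst n'.
case: (rN) (rN') => _ _ _ st [_ _ _ st'].
have jl : j < l by apply: leq_trans il.
have jl' : j' < l' by apply: leq_trans i'l'.
have asg : assigns (Inner n) x by case: rd.
apply: (step_assigned_eq (st j jl) (st' j' jl') Nj Nj' asg) => /= [y dep|a addr].
  apply: IH'; rewrite ?Nj ?Nj' ?(ltnW jl) ?(ltnW jl') //.
    by rewrite -Nj (run_rank rN) // ji.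
  by move=> a /(prov_sub (prov_data (prov_base _ _) rd dep)); apply: agr.
by apply: agr; exists (N i), x, n; split=> //; apply: prov_base.
Qed.

End Provenance.

(** * Construction of the evaluation functions *)

Theorem proposition2 (R : realType) (X : finType) (bi : builtins R)
    (S : stmt X bi) :
  exists V : node (inner (cfg_of S)) -> X -> trace R -> value R,
    (forall (N : node (inner (cfg_of S))) (x : X),
        restricted (prov N x) (V N x)) /\
    (forall (tr : trace R) (l : nat)
        (s : nat -> state R X) (N : nat -> node (inner (cfg_of S))),
        s 0 = init_state -> N 0 = START -> N l = END ->
        (forall i : nat, i < l -> step tr (s i, N i) (s i.+1, N i.+1)) ->
        forall (i : nat) (x : X), i <= l -> s i x = V (N i) x tr).
Proof.
pose P (N : node (inner (cfg_of S))) x (tr : trace R) v :=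
  exists tr' l s M i, [/\ complete_run tr' l s M, i <= l, M i = N,
    forall a, prov N x a -> tr a = tr' a & v = s i x].
(* A value is chosen among those satisfying [P]; [VNull] is the default when no suitable run passes
   through [N]. *)
pose V N x tr : value R :=
  if pselect (exists v, P N x tr v) is left ex then projT1 (cid ex) else VNull.
exists V; split=> [N x tr tr' eqtr|tr l s N s0 N0 Nl st i x il].
  (* Equal predicates give equal choices, and [P] sees the trace only on [prov N x]. *)
  suff eqP : P N x tr = P N x tr' by rewrite /V eqP.
  apply/funext => v; apply/propext; rewrite /P.
  split=> -[t [l [s [M [i [rM il Mi agr ->]]]]]];
    exists t, l, s, M, i; split=> // a pa; rewrite -agr //; last exact: eqtr.
  by apply/esym/eqtr.
have rN : complete_run tr l s N by split.
(* The given run satisfies [P], which excludes the default; [run_value] identifies the chosen value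
   with its own. *)
rewrite /V; case: pselect => [ex|[]]; last first.
  by exists (s i x), tr, l, s, N, i.
case: cid => v /= [tr' [l' [s' [M [i' [rM il' Mi' agr ->]]]]]].
by apply: (run_value rN rM).
Qed.
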